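(* Taking the supports of $\tau$-smooth Borel probability measures is a morphism of monads $\mathrm{supp}:(P,\delta,E)\to(H,\sigma,\mathcal{U})$ on $\mathsf{Top}$. That is, the maps $\mathrm{supp}_X:PX\to HX$, $p\mapsto\mathrm{supp}(p)$, are continuous and natural in the topological space $X$, and satisfy $\mathrm{supp}_X\circ\delta_X=\sigma_X$ and $\mathrm{supp}_X\circ E_X=\mathcal{U}_X\circ(\mathrm{supp}_X)_\sharp\circ\mathrm{supp}_{PX}$ for every topological space $X$.
   Context: $\mathsf{Top}$ is the category of all topological spaces and continuous maps. The monad $H$. $HX$ is the set of all closed subsets of $X$ (including $\varnothing$) with the lower Vietoris topology, generated by the sets $\{C\in HX: C\cap U\neq\varnothing\}$ for $U\subseteq X$ open. For continuous $f:X\to Y$, $f_\sharp:HX\to HY$ is $f_\sharp C=\mathrm{cl}(f(C))$. The unit is $\sigma_X(x)=\mathrm{cl}(\{x\})$ and the multiplication is $\mathcal{U}_X:HHX\to HX$, $\mathcal{U}(\mathcal{C})=\mathrm{cl}(\bigcup_{C\in\mathcal{C}}C)$. The monad $P$. A Borel measure $m$ on $X$ is $\tau$-smooth if $m(\bigcup_\lambda U_\lambda)=\sup_\lambda m(U_\lambda)$ for every directed net $(U_\lambda)$ of open sets. $PX$ is the set of $\tau$-smooth Borel probability measures on $X$ with the A-topology: the weakest topology making $p\mapsto\int f\,dp$ continuous as a map to $[0,\infty]$ with the upper topology (open sets $\varnothing$, $[0,\infty]$, $(r,\infty]$) for every lower semicontinuous $f:X\to[0,\infty]$. For continuous $f:X\to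 Y$, $f_*:PX\to PY$ is the pushforward $(f_*p)(B)=p(f^{-1}(B))$. The unit $\delta_X:X\to PX$ sends $x$ to the Dirac measure at $x$. The multiplication $E_X:PPX\to PX$ is $(E\mu)(A)=\int_{PX}p(A)\,d\mu(p)$ for Borel $A\subseteq X$. Support. For a Borel measure $m$ on $X$, $\mathrm{supp}(m)$ is the intersection of all closed subsets $C\subseteq X$ of full measure, i.e. with $m(X\setminus C)=0$. *)

(* Defs.v *)
From HB Require Import structures.
From mathcomp Require Import all_boot all_order all_algebra finmap.
From mathcomp Require Import all_classical all_reals all_analysis.
From mathcomp Require Import measurable_realfun.

Set Implicit Arguments.
Unset Strict Implicit.
Unset Printing Implicit Defensive.

Import Order.TTheory GRing.Theory Num.Theory.

Local Open Scope classical_set_scope.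

Section hyperspace.
Context (X : topologicalType).

Record hyperspace := Hyperspace {
  hyper_set :> set X ;
  hyper_closed : closed hyper_set }.

HB.instance Definition _ := gen_eqMixin hyperspace.
HB.instance Definition _ := gen_choiceMixin hyperspace.
(* The sets of those C that meet a given open U form a subbase of the lower
   Vietoris topology. *)
HB.instance Definition _ := @isSubBaseTopological.Build hyperspace
  (set X) [set U | open U]
  (fun U => [set C : hyperspace | (hyper_set C `&` U) !=set0]).

Definition hyper_cl (A : set X) : hyperspace :=
  Hyperspace (@closed_closure X A).

Definition hyper_unit (x : X) : hyperspace := hyper_cl [set x].

End hyperspace.

Definition hyper_map (X Y : topologicalType) (f : X -> Y)
  (C : hyperspace X) : hyperspace Y := hyper_cl (f @` C).

Definition hyper_mult (X : topologicalType)
    (CC : hyperspace (hyperspace X)) : hyperspace X :=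
  hyper_cl (\bigcup_(C in hyper_set CC) hyper_set C).

Lemma hyperspaceP (X : topologicalType) (C D : hyperspace X) :
  hyper_set C = hyper_set D -> C = D.
Proof.
by case: C D => [C cC] [D cD] /= CD; subst D; rewrite (Prop_irrelevance cC cD).
Qed.

(* The library's measurable types are pointed, whereas X may be empty: the
   Borel space of X is built from a proof that X is inhabited, and the point
   it carries plays no role. *)
Definition pointed_space (X : topologicalType) (hX : [set: X] !=set0) : Type :=
  X.
HB.instance Definition _ X hX := Topological.on (@pointed_space X hX).
HB.instance Definition _ X hX :=
  isPointed.Build (@pointed_space X hX) (projT1 (cid hX)).

Definition borel (X : topologicalType) (hX : [set: X] !=set0) :=
  g_sigma_algebraType (@open (pointed_space hX)).
HB.instance Definition _ X hX := Measurable.on (@borel X hX).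

Section tau_prob.
Local Open Scope ereal_scope.
Context (R : realType) (X : topologicalType).

Definition borel_set : set (set X) := <<s @open X >>.

(* A net of sets directed by inclusion; its index set is nonempty. *)
Definition tau_smooth (m : set X -> \bar R) :=
  forall (I : Type) (U : I -> set X), inhabited I ->
    (forall i, open (U i)) ->
    (forall i j, exists k, U i `<=` U k /\ U j `<=` U k) ->
  m (\bigcup_i U i) = ereal_sup [set m (U i) | i in [set: I]].

(* The library's measures are functions on all subsets, unconstrained outside
   the sigma-algebra; prob_out fixes the values there, so that two elements
   are equal exactly when they agree on the Borel sets (tau_probP). A space
   that carries a probability measure is inhabited, hence prob_inhab. *)
Record tau_prob := TauProb {
  prob_inhab : [set: X] !=set0 ;
  prob_val : probability (borel prob_inhab) R ;
  prob_smooth : tau_smooth prob_val ;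
  prob_out : forall A, ~ borel_set A -> prob_val A = 0 }.

Definition prob_fun (p : tau_prob) : set X -> \bar R := prob_val p.

Definition prob_int (p : tau_prob) (f : X -> \bar R) : \bar R :=
  \int[prob_val p]_x f x.

(* the open sets of the upper topology on [0, +oo] *)
Definition upper_open (V : set (\bar R)) :=
  [\/ V = set0, V = [set y | 0 <= y]
    | exists2 r, 0 <= r & V = [set y | r < y]].

HB.instance Definition _ := gen_eqMixin tau_prob.
HB.instance Definition _ := gen_choiceMixin tau_prob.
(* A-topology: the subbase consists of the preimages of the open sets of
   [0, +oo] under the maps p |-> \int f dp. *)
HB.instance Definition _ := @isSubBaseTopological.Build tau_prob
  ((X -> \bar R) * set (\bar R))%type
  [set fV | [/\ lower_semicontinuous fV.1, forall x, 0 <= fV.1 x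
              & upper_open fV.2]]
  (fun fV => [set p : tau_prob | fV.2 (prob_int p fV.1)]).

End tau_prob.

Coercion prob_fun : tau_prob >-> Funclass.

Lemma eq_probability d (T : measurableType d) (R : realType)
    (p q : probability T R) : p = q :> (set T -> \bar R) -> p = q.
Proof.
case: p q => [p cp] [q cq] /= pq; subst q; congr Probability.Pack.
case: cp => a b c e f g h; case: cq => a' b' c' e' f' g' h'.
have aa' : a = a'.
  by clear; case: a a' => [? ?] [? ?]; f_equal; exact: Prop_irrelevance.
subst a'; f_equal; clear.
- by case: b b' => [?] [?]; f_equal; exact: Prop_irrelevance.
- by case: c c' => [?] [?]; f_equal; exact: Prop_irrelevance.
- by case: e e' => [?] [?]; f_equal; exact: Prop_irrelevance.
- by case: f f' => [?] [?]; f_equal; exact: Prop_irrelevance.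
- by case: g g' => [?] [?]; f_equal; exact: Prop_irrelevance.
- by case: h h' => [?] [?]; f_equal; exact: Prop_irrelevance.
Qed.

Section tau_prob_lemmas.
Local Open Scope ereal_scope.
Context (R : realType) (X : topologicalType).
Implicit Type p q : tau_prob R X.

Lemma borel_measurable (hX : [set: X] !=set0) :
  (measurable : set (set (borel hX))) = @borel_set X.
Proof. by []. Qed.

Lemma open_borel (U : set X) : open U -> borel_set U.
Proof. exact: sub_sigma_algebra. Qed.

Lemma tau_probP p q : (forall A, borel_set A -> p A = q A) -> p = q.
Proof.
case: p q => [h p sp op] [h' q sq oq]; rewrite /prob_fun /= => pq.
have hh' : h = h' by exact: Prop_irrelevance.
subst h'.
have pqE : p = q :> (set X -> \bar R).
  apply/funext => A; have [/pq//|nA] := pselect (borel_set A).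
  by rewrite op // oq.
have {pqE pq}pq : p = q by exact: eq_probability.
subst q; congr TauProb; exact: Prop_irrelevance.
Qed.

Lemma tau_prob_smooth p : tau_smooth p.
Proof. exact: prob_smooth. Qed.

Lemma prob_ge0 p A : 0 <= p A.
Proof. exact: measure_ge0. Qed.

Lemma prob_le1 p A : p A <= 1.
Proof.
have [mA|/(@prob_out _ _ p) pA0] := pselect (borel_set A).
  exact: (@probability_le1 _ _ _ (prob_val p)).
by rewrite /prob_fun pA0.
Qed.

Lemma open_prob_int_gt (f : X -> \bar R) (r : \bar R) :
  lower_semicontinuous f -> (forall x, 0 <= f x) -> 0 <= r ->
  open [set p : tau_prob R X | r < prob_int p f].
Proof.
move=> lf f0 r0; set B := [set p | _].
exists [set B]; last by rewrite bigcup_set1.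
move=> _ ->; exists [fset (f, [set y | r < y])]%fset; last first.
  by rewrite set_fset1 bigcap_set1.
by move=> fV; rewrite !inE => /eqP -> /=; split => //; constructor 3; exists r.
Qed.

Lemma prob_int_indic p (U : set X) : borel_set U ->
  prob_int p (fun x => (\1_U x)%:E) = p U.
Proof. by move=> mU; rewrite /prob_int integral_indic// setIT. Qed.

Lemma open_prob_gt (U : set X) (r : \bar R) : open U ->
  open [set p : tau_prob R X | r < p U].
Proof.
move=> oU; have [r0|r0] := leP 0 r; last first.
  rewrite (_ : [set p | _] = setT); first exact: openT.
  by apply/seteqP; split=> // p _ /=; rewrite (lt_le_trans r0)// prob_ge0.
have := @open_prob_int_gt (fun x => (\1_U x)%:E) r.
under eq_set => p do rewrite (prob_int_indic _ (open_borel oU)).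
apply => //.
- apply/lower_semicontinuousP => a.
  have [a0|a0] := ltP a 0%R.
    rewrite (_ : [set p | _] = setT); first exact: openT.
    by apply/seteqP; split=> // x _ /=; rewrite lte_fin (lt_le_trans a0).

  have [a1|a1] := ltP a 1%R.
    rewrite (_ : [set p | _] = U)//; apply/seteqP; split=> x /=;
      rewrite lte_fin indicE.
    + by case: (boolP (x \in U)); [rewrite inE|rewrite ltNge a0].
    + by move=> Ux; rewrite mem_set.
  rewrite (_ : [set p | _] = set0); first exact: open0.
  apply/seteqP; split=> // x /=; rewrite lte_fin indicE ltNge.
  by rewrite (le_trans _ a1)// lern1 leq_b1.
Qed.

Lemma borel_setC (A : set X) : borel_set A -> borel_set (~` A).
Proof. by move=> mA; rewrite -setTD; exact: sigma_algebraCD. Qed.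

Lemma borel_bigcup (F : (set X)^nat) :
  (forall n, borel_set (F n)) -> borel_set (\bigcup_n F n).
Proof. exact: sigma_algebra_bigcup. Qed.

Lemma prob_setC p A : borel_set A -> p (~` A) = 1 - p A.
Proof. exact: (@probability_setC _ _ _ (prob_val p)). Qed.

Lemma prob_nneseries p (F : (set X)^nat) : (forall n, borel_set (F n)) ->
  trivIset setT F -> p (\bigcup_n F n) = \sum_(0 <= n <oo) p (F n).
Proof.
move=> mF tF; apply/esym/cvg_lim => //.
exact: (@measure_sigma_additive _ _ _ (prob_val p) F mF tF).
Qed.

Lemma measurable_prob_ev (A : set X) (h : [set: tau_prob R X] !=set0) :
  borel_set A ->
  measurable_fun [set: borel h] (fun p : borel h => (p : tau_prob R X) A).
Proof.
pose H := [set A | borel_set A /\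
  measurable_fun [set: borel h] (fun p : borel h => (p : tau_prob R X) A)].
suff /(_ A) : @borel_set X `<=` H by move=> + mA => /(_ mA)[].
rewrite /borel_set -setI_closed_g_dynkin_g_sigma_algebra; last exact: openI.
apply: smallest_sub; last first.
  move=> U oU; split; first exact: open_borel.
  apply: (measurability _ (ErealGenOInfty.measurableE R)).
  move=> /= _ [_ [a ->]] <-; rewrite setTI; apply: sub_sigma_algebra.
  by rewrite preimage_itvoy; exact: open_prob_gt.
split.
- split; first exact: open_borel openT.
  apply: (eq_measurable_fun (cst 1)) => // p _.
  exact/esym/(@probability_setT _ _ _ (prob_val p)).
- move=> B [mB HB]; split; first exact: borel_setC.
  apply: (eq_measurable_fun (fun p : borel h => 1 - (p : tau_prob R X) B)).
    by move=> p _; rewrite prob_setC.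
  by apply: emeasurable_funB => //; exact: measurable_cst.
- move=> F tF HF; split; first by apply: borel_bigcup => n; have [] := HF n.
  apply: (eq_measurable_fun (fun p : borel h =>
      \sum_(0 <= n <oo) (p : tau_prob R X) (F n))).
    by move=> p _; rewrite prob_nneseries// => n; have [] := HF n.
  apply: ge0_emeasurable_sum => [n p _ _|n _]; first exact: prob_ge0.
  by have [] := HF n.
Qed.

End tau_prob_lemmas.

Section directed_integral.
Context d (T : measurableType d) (R : realType) (mu : probability T R).

(* (j - 1)/(n + 1) if z lies in ](j - 1)/(n + 1), j/(n + 1)], for z in ]0, 1] *)
Let step (n : nat) (z : R) : R :=
  (\sum_(k < n.+1) n.+1%:R^-1 * (k.+1%:R / n.+1%:R < z)%R%:R)%R.

Let count_le n (w : R) : (0 <= w)%R -> (\sum_(k < n) (k.+1%:R < w)%R%:R <= w)%R.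
Proof.
move=> w0; elim: n => [|n IH]; first by rewrite big_ord0.
have [nw|wn] := ltP n.+1%:R%R w; last first.
  by rewrite big_ord_recr /= ltNge wn addr0.
apply: le_trans (ltW nw); rewrite -[n.+1 in leRHS]card_ord -sumr_const.
by apply: ler_sum => k _; rewrite lern1 leq_b1.
Qed.

Let count_ge n (w : R) : (w <= n.+1%:R)%R ->
  (w <= 1 + \sum_(k < n) (k.+1%:R < w)%R%:R)%R.
Proof.
elim: n => [|n IH] wn; first by rewrite big_ord0 addr0.
have [nw|{}wn] := ltP n.+1%:R%R w; last first.
  by rewrite big_ord_recr /= ltNge wn addr0; exact: IH.
rewrite (eq_bigr (fun=> 1%R)).
  by rewrite sumr_const card_ord nat1r.
by move=> k _; rewrite (le_lt_trans _ nw)// ler_nat.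
Qed.

Let stepE n (z : R) :
  step n z = (n.+1%:R^-1 * \sum_(k < n.+1) (k.+1%:R < n.+1%:R * z)%R%:R)%R.
Proof.
rewrite /step mulr_sumr; apply: eq_bigr => k _.
congr (_ * (nat_of_bool _)%:R)%R.
by rewrite ltr_pdivrMr// mulrC.
Qed.

Let step_le n (z : R) : (0 <= z)%R -> (step n z <= z)%R.
Proof.
move=> z0; rewrite stepE mulrC ler_pdivrMr// [leRHS]mulrC.
by apply: count_le; rewrite mulr_ge0.
Qed.

Let step_ge n (z : R) : (z <= 1)%R -> (z <= step n z + n.+1%:R^-1)%R.
Proof.
move=> z1; rewrite stepE -[X in (_ + X)%R]mulr1 -mulrDr mulrC ler_pdivlMr//.
rewrite addrC mulrC; apply: count_ge.
rewrite (le_trans (ler_piMr _ z1))// ler_nat.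
exact: leqnSn.
Qed.

Local Open Scope ereal_scope.

Let integral_step n (g : T -> \bar R) : measurable_fun [set: T] g ->
  (forall x, 0 <= g x <= 1) ->
  \int[mu]_x (step n (fine (g x)))%:E =
  \sum_(k < n.+1) n.+1%:R^-1%:E * mu [set x | (k.+1%:R / n.+1%:R)%:E < g x].
Proof.
move=> mg g01.
pose A (k : 'I_n.+1) := [set x | (k.+1%:R / n.+1%:R)%:E < g x].
have mA k : measurable (A k).
  rewrite -[A k]setTI; have := mg measurableT _
    (emeasurable_itv (Interval (BRight (k.+1%:R / n.+1%:R)%:E) +oo%O)).
  by rewrite preimage_itvoy.
transitivity (\int[mu]_x \sum_(k < n.+1) n.+1%:R^-1%:E * (\1_(A k) x)%:E).
  apply: eq_integral => x _; rewrite /step -sumEFin; apply: eq_bigr => k _.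
  rewrite EFinM indicE; congr (_ * (nat_of_bool _)%:R%:E).
  have /andP[g0 g1] := g01 x.
  have gf : g x \is a fin_num by rewrite ge0_fin_numE// (le_lt_trans g1)// ltry.
  by rewrite -lte_fin fineK//; apply/idP/idP; rewrite inE.
rewrite ge0_integral_sum//.
- apply: eq_bigr => k _; rewrite ge0_integralZl//.
  + by rewrite integral_indic// setIT.
  + exact/measurable_EFinP/measurable_indic.
- by move=> k; apply: measurable_funeM; exact/measurable_EFinP/measurable_indic.
Qed.

Lemma integral_directed_sup (I : Type) (g : I -> T -> \bar R)
    (G : T -> \bar R) :
  inhabited I ->
  measurable_fun [set: T] G -> (forall i, measurable_fun [set: T] (g i)) ->
  (forall x, 0 <= G x <= 1) -> (forall i x, 0 <= g i x <= G x) ->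
  (forall i j, exists k, forall x, g i x <= g k x /\ g j x <= g k x) ->
  (forall r : R, mu [set x | r%:E < G x] =
    ereal_sup [set mu [set x | r%:E < g i x] | i in [set: I]]) ->
  \int[mu]_x G x = ereal_sup [set \int[mu]_x g i x | i in [set: I]].
Proof.
move=> [i0] mG mg G01 g0G dir muG.
have g01 i x : 0 <= g i x <= 1.
  have /andP[-> /= gG] := g0G i x; have /andP[_] := G01 x.
  exact: le_trans.
have mlt r (f : T -> \bar R) : measurable_fun [set: T] f ->
    measurable [set x | r%:E < f x].
  move=> mf; rewrite -[[set x | _]]setTI.
  have := mf measurableT _ (emeasurable_itv (Interval (BRight r%:E) +oo%O)).
  by rewrite preimage_itvoy.
apply/eqP; rewrite eq_le; apply/andP; split; last first.
  apply: ge_ereal_sup => _ [i _ <-]; apply: ge0_le_integral => //.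
  - by move=> x _; have /andP[] := g01 i x.
  - by move=> x _; have /andP[] := g0G i x.
apply/lee_addgt0Pr => e e0.
have e20 : (0 < e / 2)%R by rewrite divr_gt0.
have [n ne] : exists n, (n.+1%:R^-1 < e / 2)%R.
  have [n _] := near_infty_natSinv_lt (PosNum e20).
  by move=> /(_ n (leqnn n)); exists n.
pose c k : R := (k.+1%:R / n.+1%:R)%R.
have [i Hi] : exists i, forall k, (k < n.+1)%N ->
    mu [set x | (c k)%:E < G x] <= mu [set x | (c k)%:E < g i x] + (e / 2)%:E.
  elim: n.+1 => [|m [i IH]]; first by exists i0.
  have : mu [set x | (c m)%:E < G x] - (e / 2)%:E <
         mu [set x | (c m)%:E < G x].
    by rewrite lteBlDr// lteDl// ?lte_fin// fin_num_measure//; exact: mlt.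
  rewrite [X in _ < X]muG => /ereal_sup_gt[_ [j _ <-]] Hj.
  have [k Hk] := dir i j.
  have mono r l : (forall x, g l x <= g k x) ->
      mu [set x | r%:E < g l x] <= mu [set x | r%:E < g k x].
    move=> lk; rewrite le_measure ?inE//; [exact: mlt|exact: mlt|].
    by move=> x /= /lt_le_trans; apply.
  exists k => l; rewrite ltnS leq_eqVlt => /orP[/eqP ->|lm].
    rewrite -leeBlDr// (le_trans (ltW Hj))// mono// => x.
    by have [] := Hk x.
  rewrite (le_trans (IH _ lm))// leeD2r// mono// => x.
  by have [] := Hk x.
have mstep f : measurable_fun [set: T] f ->
    measurable_fun [set: T] (fun x => (step n (fine (f x)))%:E).
  move=> mf; apply/measurable_EFinP; apply: measurable_sum => k.
  apply: measurable_funM => //.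
  rewrite (_ : (fun x => _) = (\1_([set x | (c k < fine (f x))%R]) : T -> R)%R).
    apply: measurable_indic; rewrite -[[set x | _]]setTI.
    have := (measurableT_comp (fine_measurable measurableT) mf) measurableT _
      (measurable_itv (Interval (BRight (c k)) +oo%O)).
    by rewrite preimage_itvoy.
  by apply/funext => x; rewrite indicE; congr ((nat_of_bool _)%:R)%R;
    apply/idP/idP; rewrite inE.
have step0 z : (0 <= step n z)%R by apply: sumr_ge0 => k _; rewrite mulr_ge0.
have fin01 (y : \bar R) : 0 <= y <= 1 -> y = (fine y)%:E.
  by case/andP=> f0 f1; rewrite fineK// ge0_fin_numE// (le_lt_trans f1)// ltry.
apply: (@le_trans _ _ (\int[mu]_x (step n (fine (G x)))%:E + (e / 2)%:E)).
  rewrite -[(e / 2)%:E]mule1 -(@probability_setT _ _ _ mu) -integral_cst//.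
  rewrite -ge0_integralD//; last 3 first.
  - by move=> x _; rewrite lee_fin.
  - exact: mstep.
  - by move=> x _; rewrite lee_fin ltW.
  apply: ge0_le_integral => //.
  - by move=> x _; have /andP[] := G01 x.
  - by apply: emeasurable_funD => //; exact: mstep.
  - move=> x _; rewrite {1}(fin01 (G x))// -EFinD lee_fin.
    rewrite (le_trans (step_ge n _))//; last by rewrite lerD2l ltW.
    by rewrite -lee_fin -fin01//; have /andP[] := G01 x.
rewrite integral_step//.
apply: (@le_trans _ _ (\sum_(k < n.+1) n.+1%:R^-1%:E *
    (mu [set x | (c k)%:E < g i x] + (e / 2)%:E) + (e / 2)%:E)).
  by rewrite leeD2r// lee_sum// => k _; rewrite lee_pmul2l// Hi.
under eq_bigr do rewrite ge0_muleDr// ?lee_fin ?ltW//.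
rewrite big_split /= -integral_step// sumEFin sumr_const card_ord.
rewrite -mulrnAl -mulr_natr mulVf ?pnatr_eq0// mul1r -addeA -EFinD -splitr.
rewrite leeD2r//; apply: (@le_trans _ _ (\int[mu]_x g i x)); last first.
  by apply: ereal_sup_ubound; exists i.
apply: ge0_le_integral => //.
- by move=> x _; rewrite lee_fin.
- exact: mstep.
- move=> x _; rewrite [leRHS]fin01// lee_fin step_le// -lee_fin -fin01//.
  by have /andP[] := g01 i x.
Qed.

End directed_integral.

Section borel_restr.
Local Open Scope ereal_scope.
Context (R : realType) (X : topologicalType) (hX : [set: X] !=set0).
Variable m : probability (borel hX) R.

(* m with its values outside the Borel sets replaced by 0 *)
Definition borel_restr (A : set (borel hX)) : \bar R :=
  if `[< borel_set A >] then m A else 0.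

Let borel_restrE (A : set X) : borel_set A -> borel_restr A = m A.
Proof. by move=> mA; rewrite /borel_restr asboolT. Qed.

Let borel_restr0 : borel_restr set0 = 0.
Proof. by rewrite borel_restrE ?measure0//; exact: sigma_algebra0. Qed.

Let borel_restr_ge0 A : 0 <= borel_restr A.
Proof. by rewrite /borel_restr; case: ifP. Qed.

Let borel_restr_sigma_additive : semi_sigma_additive borel_restr.
Proof.
move=> F mF tF mUF; rewrite borel_restrE//.
rewrite (_ : (fun n => _) = fun n => \sum_(0 <= i < n) m (F i)).
  exact: measure_semi_sigma_additive.
by apply/funext => n; apply: eq_bigr => i _; rewrite borel_restrE//; exact: mF.
Qed.

HB.instance Definition _ := isMeasure.Build _ _ _ borel_restr
  borel_restr0 borel_restr_ge0 borel_restr_sigma_additive.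

Let borel_restrT : borel_restr [set: borel hX] = 1.
Proof.
by rewrite borel_restrE ?probability_setT//; exact: open_borel openT.
Qed.

HB.instance Definition _ :=
  Measure_isProbability.Build _ _ _ borel_restr borel_restrT.

Hypothesis ms : @tau_smooth R X m.

Let borel_restr_smooth : @tau_smooth R X borel_restr.
Proof.
move=> I U I0 oU dU; rewrite borel_restrE.
  rewrite ms//; congr ereal_sup; apply: eq_imagel => i _.
  by rewrite borel_restrE//; exact: open_borel.
by apply: open_borel; exact: bigcup_open.
Qed.

Let borel_restr_out (A : set X) : ~ borel_set A -> borel_restr A = 0.
Proof. by move=> mA; rewrite /borel_restr asboolF. Qed.

Definition tau_prob_of : tau_prob R X :=
  @TauProb R X hX borel_restr borel_restr_smooth borel_restr_out.

Lemma tau_prob_ofE (A : set X) : borel_set A -> tau_prob_of A = m A.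
Proof. exact: borel_restrE. Qed.

End borel_restr.

Section prob_map.
Local Open Scope ereal_scope.
Context (R : realType) (X Y : topologicalType).
Variables (f : X -> Y) (cf : continuous f) (p : tau_prob R X).

Let hX : [set: X] !=set0 := prob_inhab p.

Let hY : [set: Y] !=set0.
Proof. by case: hX => x _; exists (f x). Qed.

Let mf : measurable_fun [set: borel hX] (f : borel hX -> borel hY).
Proof.
apply: (measurability _ (erefl (measurable : set (set (borel hY))))).
move=> _ [U oU <-]; rewrite setTI; apply: sub_sigma_algebra.
by move/continuousP: cf; exact.
Qed.

Definition prob_push (B : set (borel hY)) : \bar R :=
  pushforward (prob_val p) (f : borel hX -> borel hY) B.

Let push0 : prob_push set0 = 0.
Proof. by rewrite /prob_push /pushforward preimage_set0 measure0. Qed.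

Let push_ge0 B : 0 <= prob_push B. Proof. exact: measure_ge0. Qed.

Let push_sigma_additive : semi_sigma_additive prob_push.
Proof.
exact: (@measure_semi_sigma_additive _ _ _
  (pushforward (prob_val p) (f : borel hX -> borel hY))).
Qed.

HB.instance Definition _ := isMeasure.Build _ _ _ prob_push
  push0 push_ge0 push_sigma_additive.

Let pushT : prob_push [set: borel hY] = 1.
Proof. exact: (@probability_setT _ _ _ (prob_val p)). Qed.

HB.instance Definition _ :=
  Measure_isProbability.Build _ _ _ prob_push pushT.

Let push_smooth : @tau_smooth R Y prob_push.
Proof.
move=> I U I0 oU dU; rewrite /prob_push /pushforward preimage_bigcup.
apply: (prob_smooth p I0) => [i|i j]; first by move/continuousP: cf; exact.
have [k [ik jk]] := dU i j.
by exists k; split; exact: preimage_subset.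
Qed.

Definition prob_map : tau_prob R Y := tau_prob_of push_smooth.

Lemma prob_mapE (B : set Y) : borel_set B -> prob_map B = p (f @^-1` B).
Proof. exact: tau_prob_ofE. Qed.

End prob_map.

Section prob_unit.
Local Open Scope ereal_scope.
Context (R : realType) (X : topologicalType) (x : X).

Let hX : [set: X] !=set0 := ex_intro _ x I.

Let dirac_smooth : @tau_smooth R X (@dirac _ (borel hX) x R).
Proof.
move=> I U [i0] oU dU; rewrite diracE.
have [[i _ Ux]|nUx] := pselect ((\bigcup_i U i) x).
  rewrite mem_set; last by exists i.
  apply/eqP; rewrite eq_le; apply/andP; split.
    by apply: ereal_sup_ubound; exists i => //; rewrite diracE mem_set.
  by apply: ge_ereal_sup => _ [j _ <-]; rewrite diracE lee_fin lern1 leq_b1.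
rewrite memNset//; apply/esym.
rewrite (_ : [set _ | _ in _] = [set 0]) ?ereal_sup1//.
apply/seteqP; split=> [_ [i _ <-]|_ ->].
  by rewrite diracE memNset// => Ux; apply: nUx; exists i.
by exists i0 => //; rewrite diracE memNset// => Ux; apply: nUx; exists i0.
Qed.

Definition prob_unit : tau_prob R X := tau_prob_of dirac_smooth.

Lemma prob_unitE (A : set X) : borel_set A -> prob_unit A = (\1_A x)%:E.
Proof. exact: tau_prob_ofE. Qed.

End prob_unit.

Section prob_mult.
Local Open Scope ereal_scope.
Context (R : realType) (X : topologicalType).
Variable mu : tau_prob R (tau_prob R X).

Let hX : [set: X] !=set0.
Proof. by case: (prob_inhab mu) => p _; exact: prob_inhab p. Qed.

Definition prob_mean (A : set (borel hX)) : \bar R :=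
  prob_int mu (fun p => p A).

Let mean0 : prob_mean set0 = 0.
Proof.
by rewrite /prob_mean /prob_int integral0_eq.
Qed.

Let mean_ge0 A : 0 <= prob_mean A.
Proof. by apply: integral_ge0 => p _; exact: prob_ge0. Qed.

Let mean_sigma_additive : semi_sigma_additive prob_mean.
Proof.
move=> F mF tF mUF.
rewrite [X in _ --> X](_ : _ =
    \sum_(0 <= n <oo) prob_mean (F n)); last first.
  rewrite /prob_mean /prob_int -integral_nneseries//.
  - by apply: eq_integral => p _; exact: (prob_nneseries p mF tF).
  - by move=> n; apply: measurable_prob_ev; exact: mF.
by apply: is_cvg_nneseries => n _ _; exact: mean_ge0.
Qed.

HB.instance Definition _ := isMeasure.Build _ _ _ prob_mean
  mean0 mean_ge0 mean_sigma_additive.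

Let meanT : prob_mean [set: borel hX] = 1.
Proof.
rewrite -(@probability_setT _ _ _ (prob_val mu)) -[RHS]mul1e -integral_cst//.
apply: eq_integral => p _; exact: (@probability_setT _ _ _ (prob_val p)).
Qed.

HB.instance Definition _ :=
  Measure_isProbability.Build _ _ _ prob_mean meanT.

Let mean_smooth : @tau_smooth R X prob_mean.
Proof.
move=> I U I0 oU dU.
have oUU : open (\bigcup_i U i) by exact: bigcup_open.
have mUU := open_borel oUU.
have mU i := open_borel (oU i).
have leU (p : tau_prob R X) (A B : set X) :
    borel_set A -> borel_set B -> A `<=` B -> p A <= p B.
  move=> mA mB AB.
  by rewrite (@le_measure _ _ _ (prob_val p) (A : set (borel _)) B)// inE.
apply: (@integral_directed_sup _ _ _ (prob_val mu) I (fun i p => p (U i))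
  (fun p => p (\bigcup_i U i))) => //.
- exact: measurable_prob_ev.
- by move=> i; exact: measurable_prob_ev.
- by move=> p; rewrite prob_ge0 prob_le1.
- by move=> i p; rewrite prob_ge0 leU//; exact: bigcup_sup.
- move=> i j; have [k [ik jk]] := dU i j.
  by exists k => p; split; exact: leU.
- move=> r; rewrite (_ : [set p | _] =
      \bigcup_i [set p : tau_prob R X | r%:E < p (U i)]); last first.
    apply/seteqP; split=> [p /=|p [i _] /=].
      rewrite (tau_prob_smooth p I0 oU dU).
      by move=> /ereal_sup_gt[_ [i _ <-]] ri; exists i.
    by move=> /lt_le_trans; apply; apply: leU => //; exact: bigcup_sup.
  apply: (tau_prob_smooth mu I0) => [i|i j]; first exact: open_prob_gt.
  have [k [ik jk]] := dU i j; exists k.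
  by split=> p /= /lt_le_trans; apply; exact: leU.
Qed.

Definition prob_mult : tau_prob R X := tau_prob_of mean_smooth.

Lemma prob_multE (A : set X) : borel_set A ->
  prob_mult A = prob_int mu (fun p => p A).
Proof. exact: tau_prob_ofE. Qed.

End prob_mult.

Section supp.
Local Open Scope ereal_scope.
Context (R : realType) (X : topologicalType).

Definition msupp (m : set X -> \bar R) : set X :=
  \bigcap_(C in [set C | closed C /\ m (~` C) = 0]) C.

Lemma closed_msupp m : closed (msupp m).
Proof. by apply: closed_bigI => C []. Qed.

Definition supp (p : tau_prob R X) : hyperspace X :=
  Hyperspace (@closed_msupp (prob_fun p)).

End supp.

(* Main.v *)
Require Import Defs.
From HB Require Import structures.
From mathcomp Require Import all_boot all_order all_algebra finmap.
From mathcomp Require Import all_classical all_reals all_analysis.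

(** A closed set is determined by the open sets that it meets, and the support
of a tau-smooth probability measure [p] meets an open set [U] if and only if
[0 < p U] ([supp_meets_prob_gt0]).  This equivalence carries the whole proof,
and it is where tau-smoothness enters: the null open sets form a directed
family, so that their union, the complement of the support, is null.

Every assertion then becomes one about the positivity of the measure of an open
set.  The support map is continuous because [p |-> p U] is lower
semicontinuous.  For the pushforward and the Dirac measure, the measure of [U]
is known explicitly.  For the multiplication, [0 < \int p(U) dmu(p)] holds
exactly when the open set of those [p] with [0 < p U] is not null for [mu],
that is, when [supp mu] meets it, that is, when some measure in [supp mu] has a
support that meets [U].  The closures taken by the functor and the
multiplication of the hyperspace monad do not affect which open sets are met.
*)

Set Implicit Arguments.
Unset Strict Implicit.
Unset Printing Implicit Defensive.

Import Order.TTheory GRing.Theory Num.Theory.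

Local Open Scope classical_set_scope.

(** * Closed sets and the open sets that they meet *)

Section meets.
Context (X : topologicalType).

Lemma closure_meets (A U : set X) : open U ->
  closure A `&` U !=set0 <-> A `&` U !=set0.
Proof.
move=> oU; split=> [[x [clAx Ux]]|[x [Ax Ux]]].
  by apply: clAx; exact: open_nbhs_nbhs.
by exists x; split=> //; exact: subset_closure.
Qed.

(** The complement of [D] is the open set to test. *)
Lemma sub_hyperspace (C D : hyperspace X) :
  (forall U, open U -> C `&` U !=set0 -> D `&` U !=set0) -> C `<=` D.
Proof.
move=> CD x Cx; apply: contrapT => nDx.
have oD : open (~` D) by apply: closed_openC; exact: hyper_closed.
by have [|y [Dy]] := CD _ oD; [exists x|].
Qed.

Lemma eq_hyperspace (C D : hyperspace X) :
  (forall U, open U -> C `&` U !=set0 <-> D `&` U !=set0) -> C = D.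
Proof.
move=> CD; apply: hyperspaceP; apply/seteqP.
by split; apply: sub_hyperspace => U /CD[].
Qed.

Lemma open_meets (U : set X) : open U ->
  open [set C : hyperspace X | C `&` U !=set0].
Proof.
move=> oU; set B := [set C | _].
(* B is itself a subbasic open set: the union of a single intersection. *)
exists [set B]; last by rewrite bigcup_set1.
move=> _ ->; exists [fset U]%fset; last by rewrite set_fset1 bigcap_set1.
by move=> V /fset1P ->; rewrite inE.
Qed.

(** The sets of those [C] that meet a given open set form a subbase of the
lower Vietoris topology. *)
Lemma continuous_hyperspace (Y : topologicalType) (g : Y -> hyperspace X) :
  (forall U, open U -> open [set y | g y `&` U !=set0]) -> continuous g.
Proof.
move=> og y B; rewrite nbhsE => -[W [[F FI <-] [E FE Ey]] WB].
apply: (filterS (F := nbhs y) (P := g @^-1` (\bigcup_(i in F) i))).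
  by move=> z; exact: WB.
have [S SD SE] := FI _ FE; subst E.
apply: (@filterS _ _ _ (\bigcap_(U in [set` S]) [set z | g z `&` U !=set0])).
  by move=> z zS; exists (\bigcap_(U in [set` S])
    [set C : hyperspace X | C `&` U !=set0]).
apply: filter_bigI => U SU; apply: open_nbhs_nbhs; split; last exact: Ey.
by apply: og; have := SD _ SU; rewrite inE.
Qed.

End meets.

(** * The support of a tau-smooth measure *)

Section support.
Local Open Scope ereal_scope.
Context (R : realType) (X : topologicalType).
Implicit Type p : tau_prob R X.

Lemma prob_le p (A B : set X) : borel_set A -> borel_set B -> A `<=` B ->
  p A <= p B.
Proof.
move=> mA mB AB.
by rewrite (@le_measure _ _ _ (prob_val p) (A : set (borel _)) B)// inE.
Qed.

(** The complement of the support is the union of the null open sets; these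
are directed because a union of two null sets is null, so tau-smoothness gives
their union the supremum of their measures. *)
Lemma prob_suppC p : p (~` supp p) = 0.
Proof.
pose I := {V : set X | open V /\ p V = 0}.
pose V (i : I) : set X := sval i.
have oV i : open (V i) by case: (svalP i).
have pV i : p (V i) = 0 by case: (svalP i).
have i0 : I.
  exists set0; split; first exact: open0.
  exact: (@measure0 _ _ _ (prob_val p)).
have -> : ~` supp p = \bigcup_i V i.
  rewrite /supp /msupp /= setC_bigcap; apply/seteqP; split=> x.
    move=> [C [cC pC] nCx].
    by exists (exist _ (~` C) (conj (closed_openC cC) pC)).
  move=> [i _ Vx]; exists (~` V i); last by rewrite setCK.
  by split; [exact: open_closedC|rewrite setCK pV].
rewrite (tau_prob_smooth p (inhabits i0) oV).
  rewrite (_ : [set _ | _ in _] = [set 0]) ?ereal_sup1//.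
  apply/seteqP; split=> [_ [i _ <-]|_ ->]; first by rewrite pV.
  by exists i0; rewrite ?pV.
move=> i j; have mV k := open_borel (oV k).
suff pU : open (V i `|` V j) /\ p (V i `|` V j) = 0.
  exists (exist (fun W : set X => open W /\ p W = 0) _ pU).
  by split=> x Vx; [left|right].
split; first exact: openU.
rewrite -[RHS](pV i).
exact: (@measureU0 _ _ _ (prob_val p) _ _ (mV i) (mV j) (pV j)).
Qed.

(** An open set that misses the support lies in its complement, which is null;
a null open set misses the support because its complement is one of the closed
sets intersected. *)
Lemma supp_meets_prob_gt0 p (U : set X) : open U ->
  supp p `&` U !=set0 <-> 0 < p U.
Proof.
move=> oU; split=> [[x [sx Ux]]|pU].
  rewrite lt0e prob_ge0 andbT; apply/eqP => pU0.
  suff : (~` U) x by [].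
  by apply: sx; split; [exact: open_closedC|rewrite setCK].
apply: contrapT => nsU; move: pU; apply/negP; rewrite -leNgt -(prob_suppC p).
apply: prob_le; [exact: open_borel| |].
  by apply: open_borel; apply: closed_openC; exact: hyper_closed.
by move=> x Ux sx; apply: nsU; exists x.
Qed.

End support.

Section support_mult.
Local Open Scope ereal_scope.
Context (R : realType) (X : topologicalType).

(** The integral of a nonnegative function is positive exactly when the set
where it is positive is not null. *)
Lemma prob_mult_gt0 (mu : tau_prob R (tau_prob R X)) (U : set X) : open U ->
  0 < prob_mult mu U <-> 0 < mu [set p : tau_prob R X | 0 < p U].
Proof.
move=> oU; have mU := open_borel oU.
pose f (p : tau_prob R X) := p U.
have mf := @measurable_prob_ev R X U (prob_inhab mu) mU.
have mS : borel_set [set p : tau_prob R X | 0 < p U].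
  by apply: open_borel; exact: open_prob_gt.
have intE : prob_mult mu U =
    \int[prob_val mu]_(p in [set: borel (prob_inhab mu)]) `|f p|.
  rewrite prob_multE//; apply: eq_integral => p _.
  by rewrite /f gee0_abs// prob_ge0.
have H := ae_eq_integral_abs (prob_val mu) measurableT mf.
suff E : prob_mult mu U = 0 <-> mu [set p : tau_prob R X | 0 < p U] = 0.
  by rewrite !lt0e !prob_ge0 !andbT; split=> /eqP ne; apply/eqP => /E.
rewrite intE; apply: (iff_trans H); split=> [[N [mN N0 sN]]|S0].
  apply/eqP; rewrite eq_le prob_ge0 andbT -[leRHS]N0.
  apply: prob_le => // p /= p0; apply: sN => /= /(_ I) p00.
  by rewrite p00 ltxx in p0.
exists [set p : tau_prob R X | 0 < p U]; split=> // p /= np.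
rewrite lt0e prob_ge0 andbT; apply/eqP => p0; exact: np.
Qed.

End support_mult.

(** * The morphism of monads *)

Theorem mainTheorem4 (R : realType) :
  [/\ forall X : topologicalType, continuous (@supp R X),
      forall (X Y : topologicalType) (f : X -> Y) (cf : continuous f),
        @supp R Y \o prob_map cf = hyper_map f \o @supp R X,
      forall X : topologicalType,
        @supp R X \o @prob_unit R X = @hyper_unit X &
      forall X : topologicalType,
        @supp R X \o @prob_mult R X =
        @hyper_mult X \o hyper_map (@supp R X) \o @supp R (tau_prob R X)].
Proof.
split=> [X|X Y f cf|X|X].
- apply: continuous_hyperspace => U oU.
  rewrite (_ : [set p | _] = [set p : tau_prob R X | (0 < p U)%E]).
    exact: open_prob_gt.
  by apply/seteqP; split=> p /(supp_meets_prob_gt0 p oU).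
- apply/funext => p; apply: eq_hyperspace => U oU.
  have ofU : open (f @^-1` U) by move/continuousP: cf; exact.
  apply: (iff_trans (supp_meets_prob_gt0 _ oU)).
  rewrite prob_mapE; last exact: open_borel.
  apply: (iff_trans (iff_sym (supp_meets_prob_gt0 _ ofU))).
  apply: (iff_trans _ (iff_sym (closure_meets _ oU))).
  split=> [[x [sx Ux]]|[_ [[x sx <-] Ux]]]; last by exists x.
  by exists (f x); split=> //; exists x.
- apply/funext => x; apply: eq_hyperspace => U oU.
  apply: (iff_trans (supp_meets_prob_gt0 _ oU)).
  apply: (iff_trans _ (iff_sym (closure_meets _ oU))).
  rewrite prob_unitE; last exact: open_borel.
  rewrite indicE lte_fin ltr0n lt0b in_setE.
  by split=> [Ux|[_ [-> Ux]]]; [exists x|].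
- apply/funext => mu; apply: eq_hyperspace => U oU.
  apply: (iff_trans (supp_meets_prob_gt0 _ oU)).
  apply: (iff_trans (prob_mult_gt0 _ oU)).
  apply: (iff_trans (iff_sym (supp_meets_prob_gt0 _ (open_prob_gt 0%E oU)))).
  apply: (iff_trans _ (iff_sym (closure_meets _ oU))).
  (* A union meets U when the family meets the open set of those C that meet
     U; this removes the closure inside hyper_map. *)
  apply: (@iff_trans _ (hyper_map (@supp R X) (supp mu)
      `&` [set C : hyperspace X | C `&` U !=set0] !=set0)); last first.
    split=> [[C [sC [x [Cx Ux]]]]|[x [[C sC Cx] Ux]]].
      by exists x; split=> //; exists C.
    by exists C; split=> //; exists x.
  have clE := closure_meets (@supp R X @` supp mu) (open_meets oU).
  apply: (iff_trans _ (iff_sym clE)).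
  split=> [[p [sp /(supp_meets_prob_gt0 p oU) pU]]|[_ [[p sp <-] pU]]].
    by exists (supp p); split=> //; exists p.
  by exists p; split=> //; exact/(supp_meets_prob_gt0 p oU).
Qed.
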